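(* The $n$-point correlation functions $\eta^{(n)}$ and $\theta^{(n)}$ of the signed Dirac comb of the binary Rudin--Shapiro sequence exist for all integers $n\geqslant 2$. They are all determined by the value of $\eta^{(n)}(0,\dots,0)$. For odd $n$, the correlation functions $\eta^{(n)}$ and $\theta^{(n)}$ vanish.
   Context: The binary Rudin--Shapiro sequence (with balanced weights $\pm1$) is any bi-infinite word $w=(w_i)_{i\in\mathbb{Z}}\in\{1,-1\}^{\mathbb{Z}}$ satisfying, for all $m\in\mathbb{Z}$, $w_{4m+\ell}=w_m$ for $\ell\in\{0,1\}$ and $w_{4m+\ell}=(-1)^{m+\ell}w_m$ for $\ell\in\{2,3\}$ (there are four such words, given by the choices of $w_0,w_{-1}\in\{1,-1\}$). Its signed Dirac comb is $\sum_{i\in\mathbb{Z}}w_i\delta_i$, where $\delta_i$ is the unit point mass at $i$. For $m_1,\dots,m_{n-1}\in\mathbb{Z}$, the $n$-point correlation function $\eta^{(n)}$ and the signed $n$-point correlation function $\theta^{(n)}$ are defined by $$\eta^{(n)}(m_1,\dots,m_{n-1})=\lim_{N\to\infty}\frac{1}{2N+1}\sum_{i=-N}^{N}w_iw_{i+m_1}\cdots w_{i+m_{n-1}},$$ $$\theta^{(n)}(m_1,\dots,m_{n-1})=\lim_{N\to\infty}\frac{1}{2N+1}\sum_{i=-N}^{N}(-1)^iw_iw_{i+m_1}\cdots w_{i+m_{n-1}};$$ that they exist means that these limits exist for all arguments. *)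

(* Defs.v *)
From HB Require Import structures.
From mathcomp Require Import all_boot all_order all_algebra.
From mathcomp Require Import all_classical all_reals all_analysis.

Set Implicit Arguments.
Unset Strict Implicit.
Unset Printing Implicit Defensive.

Import Order.TTheory GRing.Theory Num.Theory.
Import numFieldNormedType.Exports.

Local Open Scope ring_scope.

Section RudinShapiro.

Variable R : realType.

Definition rudin_shapiro (w : int -> R) : Prop :=
  (forall i : int, w i = 1 \/ w i = -1) /\
  (forall (m : int) (l : nat),
     (l \in [:: 0; 1]%N -> w (4 * m + l%:Z) = w m) /\
     (l \in [:: 2; 3]%N -> w (4 * m + l%:Z) = (-1) ^ (m + l%:Z) * w m)).

(* An n-point correlation function has n - 1 arguments m_1, ..., m_{n-1},
   stored in a row vector of length k = n - 1 with 0-based indices. *)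
Definition corr_term (w : int -> R) (k : nat) (m : 'rV[int]_k) (i : int) : R :=
  w i * \prod_(j < k) w (i + m ord0 j).

(* (1 / (2N + 1)) * sum_{i = -N}^{N} f i, summed over t = i + N *)
Definition sym_mean (f : int -> R) (N : nat) : R :=
  (2 * N + 1)%N%:R^-1 * \sum_(0 <= t < (2 * N + 1)%N) f (t%:Z - N%:Z).

Definition corr_mean (w : int -> R) (k : nat) (m : 'rV[int]_k) : nat -> R :=
  sym_mean (corr_term w m).

Definition signed_corr_mean (w : int -> R) (k : nat) (m : 'rV[int]_k) : nat -> R :=
  sym_mean (fun i : int => (-1) ^ i * corr_term w m i).

(* eta^(n) and theta^(n), for n = k + 1; meaningful when the limits exist *)
Definition corr (w : int -> R) (k : nat) (m : 'rV[int]_k) : R :=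
  limn (corr_mean w m).

Definition signed_corr (w : int -> R) (k : nat) (m : 'rV[int]_k) : R :=
  limn (signed_corr_mean w m).

(* Renormalisation.  Put m_0 = 0, i = 4 i' + r and m_j + r = 4 q_j + s_j with
   0 <= s_j < 4.  The defining relations of w give
     prod_j w_{i + m_j}
       = sgn * ((-1)^i')^h * prod_j w_{i' + q_j},
   where h = #{j | s_j >= 2} and sgn = prod_{j | s_j >= 2} (-1)^(q_j + s_j).
   Below, h and sgn split off the factor j = 0, for which q_0 = 0, s_0 = r. *)
Definition rs_quo (k : nat) (m : 'rV[int]_k) (r : nat) : 'rV[int]_k :=
  \row_j ((m ord0 j + r%:Z) %/ 4)%Z.

Definition rs_rem (k : nat) (m : 'rV[int]_k) (r : nat) : 'rV[int]_k :=
  \row_j ((m ord0 j + r%:Z) %% 4)%Z.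

Definition rs_high (k : nat) (m : 'rV[int]_k) (r : nat) : nat :=
  ((2 <= r) + #|[set j : 'I_k | (2 <= rs_rem m r ord0 j)%R]|)%N.

Definition rs_sgn (k : nat) (m : 'rV[int]_k) (r : nat) : R :=
  (if (2 <= r)%N then (-1) ^+ r else 1) *
  \prod_(j < k | 2 <= rs_rem m r ord0 j)
     (-1) ^ (rs_quo m r ord0 j + rs_rem m r ord0 j).

Definition rs_renorm (k : nat) (f g : 'rV[int]_k -> R) : Prop :=
  forall m : 'rV[int]_k,
    f m = 4^-1 * \sum_(r < 4) rs_sgn m r *
            (if odd (rs_high m r) then g else f) (rs_quo m r) /\
    g m = 4^-1 * \sum_(r < 4) (-1) ^+ r * rs_sgn m r *
            (if odd (rs_high m r) then g else f) (rs_quo m r).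

End RudinShapiro.

(* Main.v *)
(* Means are taken uniformly over all windows of Z.  Cutting a window into
   blocks {4i, ..., 4i+3} turns the recursion of w into a recursion for the
   correlations at lag vector m in terms of those at the four lag vectors
   rs_quo m r.  Each of these is either m itself or has smaller l^1 norm, and
   for m <> 0 at most one r gives m.  Since a block has four points, a
   self-reference with coefficient of modulus at most 2 is a contraction on
   normalised sums: this yields existence of the means by induction on the
   norm, and uniqueness of the solution of the recursion by the same induction.
   At m = 0 the product is constant 1 for even n; for odd n the self-reference
   has coefficient 2 and the mean is 0. *)
Require Import Defs.
From HB Require Import structures.
From mathcomp Require Import all_boot all_order all_algebra.
From mathcomp Require Import all_classical all_reals all_analysis.
From mathcomp Require Import zify ring lra.

Set Implicit Arguments.
Unset Strict Implicit.
Unset Printing Implicit Defensive.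

Import Order.TTheory GRing.Theory Num.Theory.
Import numFieldNormedType.Exports.

Local Open Scope ring_scope.

(** * Means along windows, uniform in the position *)

Section UniformMean.
Variable R : realType.
Implicit Types (f g : int -> R) (a : int) (L : nat).

Definition window f a L : R := \sum_(t < L) f (a + t%:Z).

(* [K] does not depend on the position [a] of the window. *)
Definition has_mean f (c : R) : Prop :=
  forall d, 0 < d ->
  exists K, forall a L, `|window f a L - c * L%:R| <= d * L%:R + K.

Definition block_sum f (i : int) : R := \sum_(r < 4) f (4 * i + r%:Z).

Lemma window_cat f a L1 L2 :
  window f a (L1 + L2) = window f a L1 + window f (a + L1%:Z) L2.
Proof.
rewrite /window big_split_ord /=; congr (_ + _).
by apply: eq_bigr => t _; congr f; lia.
Qed.

Lemma window_block f a L : window f (4 * a) (4 * L)%N = window (block_sum f) a L.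
Proof.
elim: L => [|L IHL]; first by rewrite muln0 /window !big_ord0.
rewrite mulnS addnC window_cat IHL [RHS]/window big_ord_recr /=; congr (_ + _).
by apply: eq_bigr => t _; congr f; lia.
Qed.

Lemma normr_window_le f M a L : (forall i, `|f i| <= M) -> `|window f a L| <= M * L%:R.
Proof.
move=> fM; rewrite /window (le_trans (ler_norm_sum _ _ _)) //.
by rewrite (le_trans (ler_sum _ (fun t _ => fM _))) // sumr_const card_ord mulr_natr.
Qed.

(* [a = 4 a' + s]: the window [a, a + L) and the union of the 4-blocks with
   index in [a', a' + L / 4) differ by at most 3 points on the left and 6 on
   the right. *)
Lemma window_block_approx f M a L : (forall i, `|f i| <= M) ->
  `|window f a L - window (block_sum f) (a %/ 4)%Z (L %/ 4)| <= 9 * M.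
Proof.
move=> fM.
have M0 : 0 <= M by apply: le_trans (fM 0).
pose b := (4 * (a %/ 4)%Z); pose s := `|(a %% 4)%Z|%N.
pose t := (s + L - 4 * (L %/ 4))%N.
have aE : a = b + s%:Z by rewrite /b /s; lia.
have := window_cat f b s L; rewrite -aE.
have -> : (s + L = 4 * (L %/ 4) + t)%N by rewrite /t; lia.
rewrite window_cat window_block => E.
have -> : window f a L - window (block_sum f) (a %/ 4)%Z (L %/ 4) =
  window f (b + (4 * (L %/ 4))%N%:Z) t - window f b s by lra.
rewrite (le_trans (ler_normB _ _)) //.
have t6 : (t <= 6)%N by rewrite /t /s; lia.
have s3 : (s <= 3)%N by rewrite /s; lia.
have -> : 9 * M = M * 6%:R + M * 3%:R by ring.
by apply: lerD; apply: le_trans (normr_window_le _ _ fM) _;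
  rewrite ler_wpM2l // ler_nat.
Qed.

Lemma has_mean_eq f g c : f =1 g -> has_mean f c -> has_mean g c.
Proof. by move=> /funext->. Qed.

Lemma has_mean_cst c : has_mean (fun=> c) c.
Proof.
move=> d d0; exists 0 => a L.
rewrite /window sumr_const card_ord mulr_natr subrr normr0 addr0.
by rewrite mulr_ge0 // ltW.
Qed.

Lemma has_meanZ f c k : has_mean f c -> has_mean (fun i => k * f i) (k * c).
Proof.
move=> fc d d0.
(* The summand 1 keeps the divisor positive when [k] is 0. *)
have k0 : 0 < `|k| + 1 by rewrite ltr_wpDl.
have [K HK] := fc (d / (`|k| + 1)) (divr_gt0 d0 k0).
exists (`|k| * K) => a L.
rewrite /window -mulr_sumr -mulrA -mulrBr normrM.
rewrite (le_trans (ler_wpM2l (normr_ge0 k) (HK a L))) // mulrDr lerD2r mulrA.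
rewrite ler_wpM2r // mulrA ler_pdivrMr // mulrC ler_wpM2l ?(ltW d0) //.
by rewrite lerDl.
Qed.

Lemma has_meanD f g c c' :
  has_mean f c -> has_mean g c' -> has_mean (fun i => f i + g i) (c + c').
Proof.
move=> fc gc d d0; have d20 : 0 < d / 2 by rewrite divr_gt0.
have [K HK] := fc _ d20; have [K' HK'] := gc _ d20.
exists (K + K') => a L; rewrite /window big_split /=.
rewrite (_ : _ - _ = (window f a L - c * L%:R) + (window g a L - c' * L%:R));
  last by rewrite /window; ring.
rewrite (le_trans (ler_normD _ _)) // (le_trans (lerD (HK _ _) (HK' _ _))) //.
by rewrite le_eqVlt; apply/orP; left; apply/eqP; field.
Qed.

Lemma has_mean_sum (I : finType) (P : pred I) (f : I -> int -> R) c :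
  (forall x, P x -> has_mean (f x) (c x)) ->
  has_mean (fun i => \sum_(x | P x) f x i) (\sum_(x | P x) c x).
Proof.
move=> fc.
elim: (index_enum I) => [|x r IHr].
  rewrite big_nil; apply: has_mean_eq (has_mean_cst 0) => i.
  by rewrite big_nil.
rewrite big_cons; case: ifPn => Px.
  apply: has_mean_eq (has_meanD (fc x Px) IHr) => i.
  by rewrite big_cons Px.
by apply: has_mean_eq IHr => i; rewrite big_cons (negbTE Px).
Qed.

Lemma has_mean_cvg f c : has_mean f c -> (sym_mean f @ \oo --> c)%classic.
Proof.
move=> fc; apply/cvgrPdist_le => e e0.
have e20 : 0 < e / 2 by rewrite divr_gt0.
have [K HK] := fc _ e20.
near=> N.
pose L := (2 * N + 1)%N.
have L0 : 0 < L%:R :> R by rewrite ltr0n /L; lia.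
have -> : sym_mean f N = L%:R^-1 * window f (- N%:Z) L.
  rewrite /sym_mean big_mkord; congr (_ * _).
  by apply: eq_bigr => t _; congr f; rewrite addrC.
have -> : c - L%:R^-1 * window f (- N%:Z) L =
    - (L%:R^-1 * (window f (- N%:Z) L - c * L%:R)).
  by field; rewrite gt_eqF.
rewrite normrN normrM gtr0_norm ?invr_gt0 // mulrC ler_pdivrMr //.
apply: le_trans (HK _ _) _.
(* For such [N] the fixed error [K] fits into the other half, [e / 2 * L], of the allowance. *)
have KN : K / (e / 2) <= N%:R by near: N; exact: nbhs_infty_ger.
have NL : N%:R <= L%:R :> R by rewrite ler_nat /L; lia.
have := le_trans KN NL; rewrite ler_pdivrMr // => KL.
by lra.
Unshelve. all: by end_near. Qed.

Definition mean f : R := limn (sym_mean f).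

Lemma has_mean_mean f c : has_mean f c -> mean f = c.
Proof. by move=> /has_mean_cvg/cvg_lim; apply. Qed.

(** * Contraction for block recursions with one self-reference *)

Section Contraction.
Variables (I : finType) (F G : I -> int -> R) (p : I -> I) (u g c : I -> R).
Variable M : R.
Hypothesis F_le : forall x i, `|F x i| <= M.
Hypothesis u_le : forall x, `|u x| <= 2.
Hypothesis G_mean : forall x, has_mean (G x) (g x).
Hypothesis F_block : forall x i, block_sum (F x) i = u x * F (p x) i + G x i.
Hypothesis c_eq : forall x, 4 * c x = u x * c (p x) + g x.

(** One [K] serves all [x], because the recursion passes from [x] to [p x]. *)
Let deviation_le (d : R) : Prop :=
  exists K, forall x a L, `|window (F x) a L - c x * L%:R| <= d * L%:R + K.

(** A window of length [L] holds about [L / 4] blocks. Up to constants, the self-reference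
    contributes at most [2 * d * L / 4] on them, and [G], whose mean is taken with the same error
    [d], at most [d * L / 4]. *)
Lemma deviation_contracts d : 0 < d -> deviation_le d -> deviation_le (3 / 4 * d).
Proof using F_le u_le G_mean F_block c_eq.
move=> d0 [K HK].
have /choice[KG HKG] := fun x => G_mean x d0.
pose B : R := \sum_x (`|c x| + `|KG x|).
exists (9 * M + 3 * B + 2 * `|K| + B) => x a L.
have xB : `|c x| + `|KG x| <= B.
  by rewrite /B (bigD1 x) //= lerDl sumr_ge0 // => y _; rewrite addr_ge0.
set a' := (a %/ 4)%Z; set L' := (L %/ 4)%N.
have wE : window (block_sum (F x)) a' L' =
    u x * window (F (p x)) a' L' + window (G x) a' L'.
  rewrite /window mulr_sumr -big_split /=.
  by apply: eq_bigr => t _; rewrite F_block.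
have LE : L%:R = 4 * L'%:R + (L %% 4)%:R :> R.
  by rewrite {1}(divn_eq L 4) natrD natrM mulrC.
have L3 : (L %% 4)%:R <= 3 :> R by rewrite ler_nat -ltnS ltn_pmod.
(* The four errors come from the block boundaries, the rounding of [L] to a multiple of 4, the
   self-reference and [G]; [c_eq] cancels the main terms. *)
have -> : window (F x) a L - c x * L%:R =
  (window (F x) a L - window (block_sum (F x)) a' L')
  - c x * (L %% 4)%:R
  + u x * (window (F (p x)) a' L' - c (p x) * L'%:R)
  + (window (G x) a' L' - g x * L'%:R).
  by rewrite wE LE (_ : g x = 4 * c x - u x * c (p x)); [ring | rewrite c_eq; ring].
have h1 := window_block_approx a L (F_le x).
have h2 : `|c x * (L %% 4)%:R| <= 3 * B.
  rewrite normrM normr_nat mulrC ler_pM //.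
  by rewrite (le_trans _ xB) // lerDl.
have h3 : `|u x * (window (F (p x)) a' L' - c (p x) * L'%:R)|
    <= 2 * (d * L'%:R + `|K|).
  by rewrite normrM ler_pM // (le_trans (HK _ _ _)) // lerD2l ler_norm.
have h4 : `|window (G x) a' L' - g x * L'%:R| <= d * L'%:R + B.
  rewrite (le_trans (HKG _ _ _)) // lerD2l (le_trans (ler_norm _)) //.
  by rewrite (le_trans _ xB) // lerDr.
have L'L : 4 * (d * L'%:R) <= d * L%:R.
  by rewrite mulrCA ler_wpM2l ?(ltW d0) // LE lerDl.
rewrite (le_trans (ler_normD _ _)) //.
have := ler_normB (window (F x) a L - window (block_sum (F x)) a' L')
  (c x * (L %% 4)%:R).
have := ler_normD (window (F x) a L - window (block_sum (F x)) a' L'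
  - c x * (L %% 4)%:R) (u x * (window (F (p x)) a' L' - c (p x) * L'%:R)).
lra.
Qed.

Lemma contraction_has_mean x : has_mean (F x) (c x).
Proof using F_le u_le G_mean F_block c_eq.
pose d0 := `|M| + \sum_y `|c y| + 1.
have d00 : 0 < d0 by rewrite ltr_wpDl // addr_ge0 // sumr_ge0.
(* Boundedness of [F] gives a first rate, which powers of 3/4 then push below any [d]. *)
have base : deviation_le d0.
  exists 0 => y a L; rewrite addr0 (le_trans (ler_normB _ _)) //.
  rewrite normrM normr_nat (le_trans (lerD (normr_window_le _ _ (F_le y)) (lexx _))) //.
  rewrite -mulrDl ler_wpM2r // /d0 -addrA lerD ?ler_norm //.
  rewrite (bigD1 y) //= -addrA lerDl addr_ge0 // sumr_ge0 //.
have iter j : deviation_le ((3 / 4) ^+ j * d0).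
  elim: j => [|j IHj]; first by rewrite expr0 mul1r.
  rewrite exprS -mulrA; apply: deviation_contracts => //.
  by rewrite mulr_gt0 // exprn_gt0 // divr_gt0.
move=> d dpos.
have [j jd] : exists j, (3 / 4) ^+ j * d0 <= d.
  have n1 : `|3 / 4 : R| < 1 by rewrite gtr0_norm; lra.
  have /cvgrPdist_le/(_ _ (divr_gt0 dpos d00))[j _ /(_ j (leqnn j))] := cvg_expr n1.
  rewrite sub0r normrN ger0_norm ?exprn_ge0 ?divr_ge0 // => jd.
  by exists j; rewrite -ler_pdivlMr.
have [K HK] := iter j; exists K => a L.
by rewrite (le_trans (HK _ _ _)) // lerD2r ler_wpM2r.
Qed.

End Contraction.
End UniformMean.

(** * The recursion on lag vectors and uniqueness of its solution *)

Section Renormalisation.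
Variables (R : realType) (k : nat).
Implicit Types (m : 'rV[int]_k) (b : bool).

(** The map [x] to [(x + r) %/ 4] moves an integer towards 0 and never past it, so an entry that
    changes loses modulus. *)
Lemma rs_quo_contracts m (r : nat) : (r < 4)%N -> rs_quo m r != m ->
  (\sum_j `|rs_quo m r ord0 j| < \sum_j `|m ord0 j|)%N.
Proof.
move=> r4 neq.
have le_abs (x : int) : (`|((x + r%:Z) %/ 4)%Z|%N <= `|x|)%N by lia.
have [j jneq] : exists j, rs_quo m r ord0 j != m ord0 j.
  apply/existsP; apply: contraNT neq => /existsPn eqm.
  by apply/eqP/rowP => j; apply/eqP/negbNE/eqm.
rewrite (bigD1 j) //= [ltnRHS](bigD1 j) //= -addSn leq_add //.
  by move: jneq; rewrite mxE; lia.
by apply: leq_sum => l _; rewrite mxE.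
Qed.

(* Self-loops [rs_quo m r = m] are excluded from the induction hypothesis. *)
Lemma rs_ind (Q : 'rV[int]_k -> Prop) : Q 0 ->
  (forall m, m != 0 ->
     (forall r : 'I_4, rs_quo m r != m -> Q (rs_quo m r)) -> Q m) ->
  forall m, Q m.
Proof.
move=> Q0 Qstep m.
have [s] := ubnP (\sum_j `|m ord0 j|); elim: s m => // s IHs m ms.
have [-> //|m0] := eqVneq m 0.
apply: Qstep => // r mr; apply: IHs.
by apply: leq_trans (rs_quo_contracts (ltn_ord r) mr) _; rewrite -ltnS.
Qed.

(* Solving [3 m_j = r - s] with [0 <= r, s < 4]: an entry 1 forces [r = 3] and
   an entry -1 forces [r = 0]. *)
Lemma rs_quo_fix_inj m (r r' : 'I_4) :
  m != 0 -> rs_quo m r = m -> rs_quo m r' = m -> r = r'.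
Proof.
move=> /rV0Pn[j mj] /rowP/(_ j) + /rowP/(_ j); rewrite !mxE.
move: mj; rewrite (_ : m 0 j = m ord0 j) //; set x := m ord0 j => x0 h h'.
by apply: val_inj => /=; case: r r' h h' => r r4 [r' r4'] /=; lia.
Qed.

Lemma rs_sgn_norm m r : `|rs_sgn R m r| = 1.
Proof.
rewrite normrM normr_prod big1 ?mulr1; last first.
  by move=> j _; rewrite expN1r normrX normrN1 expr1n.
by case: ifP => _; rewrite ?normr1 // normrX normrN1 expr1n.
Qed.

(** The flag [b] marks the signed correlation; its extra sign is $(-1)^{4i+r} = (-1)^r$. *)
Definition rs_coef b m (r : nat) : R := (-1) ^+ (b * r)%N * rs_sgn R m r.

Lemma rs_coef_norm b m r : `|rs_coef b m r| = 1.
Proof. by rewrite normrM rs_sgn_norm normrX normrN1 expr1n mulr1. Qed.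

Definition renorm_sum (h : bool -> 'rV[int]_k -> R) b m (r : 'I_4) : R :=
  rs_coef b m r * h (odd (rs_high m r)) (rs_quo m r).

(** Indexing the pair by a boolean merges the two equations, so that the signed and unsigned cases
    are argued together. *)
Lemma rs_renormP (h : bool -> 'rV[int]_k -> R) :
  rs_renorm (h false) (h true) <->
  forall b m, 4 * h b m = \sum_r renorm_sum h b m r.
Proof.
have four : (4 : R) != 0 by rewrite pnatr_eq0.
have E b m : \sum_r renorm_sum h b m r =
    \sum_(r < 4) (if b then (-1) ^+ r else 1) * rs_sgn R m r *
      (if odd (rs_high m r) then h true else h false) (rs_quo m r).
  apply: eq_bigr => r _; rewrite /renorm_sum /rs_coef.
  by case: b; rewrite ?mul1n ?mul0n ?expr0; case: odd.
split=> [H b m|H m]; last first.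
  split; apply: (mulfI four); rewrite mulVKf // H E //.
  by apply: eq_bigr => r _; rewrite mul1r.
rewrite E; have [H0 H1] := H m; case: b; first by rewrite H1 mulVKf.
by rewrite H0 mulVKf //; apply: eq_bigr => r _; rewrite mul1r.
Qed.

(** At lag 0 all $n = k + 1$ factors are high for [r] = 2, 3 and none for [r] = 0, 1. For even $n$
    only [h false] occurs, with four equal signs if unsigned and alternating ones if signed. For odd
    $n$ the two terms with [h (~~ b)] cancel and the two with [h b] add up. *)
Lemma renorm_sum0 (h : bool -> 'rV[int]_k -> R) b :
  \sum_r renorm_sum h b 0 r =
  if odd k.+1 then 2 * h b 0 else 4 * (~~ b)%:R * h false 0.
Proof.
have quo0 (r : nat) : (r < 4)%N -> rs_quo (0 : 'rV[int]_k) r = 0.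
  by move=> r4; apply/rowP => j; rewrite !mxE; lia.
have rem0 (r : nat) j : (r < 4)%N -> rs_rem (0 : 'rV[int]_k) r ord0 j = r.
  by move=> r4; rewrite !mxE; lia.
have high0 (r : nat) : (r < 4)%N ->
    rs_high (0 : 'rV[int]_k) r = (if 2 <= r then k.+1 else 0)%N.
  move=> r4; rewrite /rs_high -sum1_card.
  under eq_bigl do rewrite inE rem0 //.
  by rewrite lez_nat; case: (2 <= r)%N; rewrite ?big_pred0_eq // sum1_card cardT size_enum_ord.
have sgn0 (r : nat) : (r < 4)%N ->
    rs_sgn R (0 : 'rV[int]_k) r = if (2 <= r)%N then (-1) ^+ (r * k.+1) else 1.
  move=> r4; rewrite /rs_sgn.
  under eq_bigl do rewrite rem0 //.
  under eq_bigr do rewrite rem0 // quo0 // mxE add0r.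
  rewrite lez_nat; case: (2 <= r)%N; last by rewrite big_pred0_eq mulr1.
  by rewrite prodr_const card_ord -exprS -exprM.
have sgnE n : (-1) ^+ n = if odd n then -1 else 1 :> R.
  by rewrite -signr_odd; case: odd; rewrite ?expr1 ?expr0.
rewrite !big_ord_recl big_ord0 /renorm_sum /rs_coef !quo0 // !high0 // !sgn0 //.
rewrite /bump !sgnE !oddM /=.
by case: b; case: (odd k) => /=; ring.
Qed.

(** The difference of two solutions obeys the same linear recursion. By induction only a self-loop
    survives, and its coefficient of modulus 1 cannot balance the factor 4. *)
Lemma rs_renorm_unique (f g f' g' : 'rV[int]_k -> R) :
  rs_renorm f g -> rs_renorm f' g' -> f 0 = f' 0 -> f =1 f' /\ g =1 g'.
Proof.
pose h b := if b then g else f; pose h' b := if b then g' else f'.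
move=> /(rs_renormP h) H /(rs_renormP h') H' f0.
(* At lag 0 the signed value satisfies [4 * x = 2 * x] or [4 * x = 0], so only the unsigned one is
   free. *)
have signed0 (l : bool -> 'rV[int]_k -> R) :
    (forall b m, 4 * l b m = \sum_r renorm_sum l b m r) -> l true 0 = 0.
  by move=> /(_ true 0); rewrite renorm_sum0; case: ifP => _ /=; lra.
suff hh' m : forall b, h b m = h' b m.
  by split=> m; [exact: (hh' m false)|exact: (hh' m true)].
elim/rs_ind: m => [[]|m m0 IH]; first by rewrite !signed0.
  exact: f0.
pose d b := h b m - h' b m.
suff d0 b : d b = 0 by move=> b; apply/eqP; rewrite -subr_eq0 -/(d b) d0.
have dE c : 4 * d c = \sum_(r < 4 | rs_quo m r == m)
    rs_coef c m r * d (odd (rs_high m r)).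
  rewrite mulrBr H H' -sumrB [RHS]big_mkcond; apply: eq_bigr => r _.
  rewrite /renorm_sum -mulrBr; case: eqVneq => [->//|/IH ->].
  by rewrite subrr mulr0.
have [r0 /eqP r0m|none] := pickP (fun r : 'I_4 => rs_quo m r == m); last first.
  by have := dE b; rewrite big_pred0 // => /eqP; rewrite mulf_eq0 pnatr_eq0 => /eqP.
have {}dE c : 4 * d c = rs_coef c m r0 * d (odd (rs_high m r0)).
  rewrite dE (big_pred1 r0) // => r /=; apply/eqP/eqP => [rm|->//].
  exact: rs_quo_fix_inj m0 rm r0m.
(* Both values of [c] lead to this parity, where the equation closes up as [4 * x = x] or
   [4 * x = - x]. *)
have dp : d (odd (rs_high m r0)) = 0.
  have := dE (odd (rs_high m r0)); set x := d _.
  have /eqP := rs_coef_norm (odd (rs_high m r0)) m r0.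
  by rewrite eqr_norml => /andP[/orP[]/eqP-> _]; lra.
by have := dE b; rewrite dp mulr0 => /eqP; rewrite mulf_eq0 pnatr_eq0 => /eqP.
Qed.

(** * Existence and renormalisation of the correlations *)

Section Correlations.
Variable w : int -> R.
Hypothesis w_rs : rudin_shapiro w.

(** Its [mean] is convertible to [corr w m] for [false] and to [signed_corr w m] for [true]. *)
Definition twisted b m : int -> R :=
  if b then fun i => (-1) ^ i * corr_term w m i else corr_term w m.

Lemma rs_block (q s : int) : 0 <= s < 4 ->
  w (4 * q + s) = (if 2 <= s then (-1) ^ (q + s) else 1) * w q.
Proof using w_rs.
case: s => // s; rewrite ltz_nat !lez_nat => /= s4; have [lo hi] := w_rs.2 q s.
have [s2|s2] := leqP 2 s; last first.
  by rewrite lo ?mul1r // !inE; lia.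
by rewrite hi // !inE; lia.
Qed.

Lemma corr_term_block m (r : nat) (i : int) : (r < 4)%N ->
  corr_term w m (4 * i + r%:Z) =
  rs_sgn R m r * ((-1) ^ i) ^+ rs_high m r * corr_term w (rs_quo m r) i.
Proof using w_rs.
move=> r4; have N1 : (-1 : R) != 0 by rewrite oppr_eq0 oner_eq0.
have wj j : w (4 * i + r%:Z + m ord0 j) =
    (if 2 <= rs_rem m r ord0 j
     then (-1) ^ (rs_quo m r ord0 j + rs_rem m r ord0 j) * (-1) ^ i else 1)
    * w (i + rs_quo m r ord0 j).
  have -> : 4 * i + r%:Z + m ord0 j =
      4 * (i + rs_quo m r ord0 j) + rs_rem m r ord0 j by rewrite !mxE; lia.
  rewrite rs_block; last by rewrite mxE; lia.
  by case: ifP => // _; rewrite -expfzDr //; congr (_ ^ _ * _); ring.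
rewrite /corr_term; under eq_bigr do rewrite wj.
rewrite big_split -big_mkcond big_split /=.
have -> : \prod_(j | 2 <= rs_rem m r ord0 j) (-1) ^ i =
    ((-1) ^ i : R) ^+ #|[set j | 2 <= rs_rem m r ord0 j]|.
  by rewrite -prodr_const; apply: eq_bigl => j; rewrite inE.
(* The factor without lag supplies the parts of [rs_sgn] and [rs_high] that stand outside the range
   of [j]. *)
rewrite rs_block; last by lia.
rewrite /rs_sgn /rs_high exprD lez_nat.
case: ifP => _ /=; last by ring.
by rewrite expfzDr // expr1 -exprnP; ring.
Qed.

(** Only the parity of the power of $(-1)^i$ matters, so this power is exactly a twist of the
    product at the new lags. *)
Lemma twisted_block b m (r : 'I_4) (i : int) :
  twisted b m (4 * i + r%:Z) =
  rs_coef b m r * twisted (odd (rs_high m r)) (rs_quo m r) i.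
Proof using w_rs.
have N1 : (-1 : R) != 0 by rewrite oppr_eq0 oner_eq0.
have twE c l j : twisted c l j = ((-1) ^ j) ^+ c * corr_term w l j.
  by case: c; rewrite /twisted ?expr1 // mul1r.
rewrite !twE corr_term_block // /rs_coef.
have -> : ((-1) ^ i) ^+ rs_high m r = ((-1) ^ i : R) ^+ odd (rs_high m r).
  rewrite expN1r -(signr_odd _ `|i|) -!exprM -signr_odd -[RHS]signr_odd.
  by rewrite !oddM !oddb.
have -> : (((-1) ^ (4 * i + r%:Z)) ^+ b : R) = (-1) ^+ (b * r).
  have four1 : (-1) ^ 4 = 1 :> R by rewrite -exprnP -signr_odd expr0.
  case: b; last by rewrite expr0.
  by rewrite expr1 mul1n expfzDr // -exprz_exp four1 exp1rz mul1r.
ring.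
Qed.

Lemma rudin_shapiro_norm (i : int) : `|w i| = 1.
Proof using w_rs. by case: (w_rs.1 i) => ->; rewrite ?normrN normr1. Qed.

Lemma twisted_norm b m (i : int) : `|twisted b m i| = 1.
Proof using w_rs.
have term1 : `|corr_term w m i| = 1.
  by rewrite normrM normr_prod rudin_shapiro_norm mul1r big1 // => j _; rewrite rudin_shapiro_norm.
by case: b; rewrite /twisted // normrM expN1r normrX normrN1 expr1n mul1r.
Qed.

Lemma twisted_block_sum b m i :
  block_sum (twisted b m) i = \sum_r renorm_sum (fun c l => twisted c l i) b m r.
Proof using w_rs. by apply: eq_bigr => r _; rewrite twisted_block. Qed.

Lemma twisted0_even_points (i : int) : odd k -> twisted false 0 i = 1.
Proof using w_rs.
move=> kodd; rewrite /twisted /corr_term.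
under eq_bigr do rewrite mxE addr0.
rewrite prodr_const card_ord -exprS.
by case: (w_rs.1 i) => ->; rewrite ?expr1n // -signr_odd /= kodd.
Qed.

Lemma twisted0_mean b : has_mean (twisted b 0) (odd k && ~~ b)%:R.
Proof using w_rs.
pose G c (i : int) : R := 4 * (odd k && ~~ c)%:R.
(* For odd [k], that is even $n$, the product is the known constant 1 and goes into [G]. For odd $n$
   the self-reference has coefficient 2, and [4 * c = 2 * c] forces the mean 0. *)
pose u (c : bool) : R := if odd k then 0 else 2.
apply: (@contraction_has_mean R bool (fun c => twisted c 0) G id u
  (fun c => 4 * (odd k && ~~ c)%:R) (fun c => (odd k && ~~ c)%:R) 1).
- by move=> c i; rewrite twisted_norm.
- by move=> c; rewrite /u; case: ifP => _; rewrite ?normr0 // normr_nat.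
- by move=> c; exact: has_mean_cst.
- move=> c i; rewrite twisted_block_sum renorm_sum0 /u /G /=.
  have := twisted0_even_points i; case: (odd k) => /= [->//|_].
    by rewrite mul0r add0r mulr1.
  by rewrite mulr0 addr0.
- by move=> c; rewrite /u; case: (odd k) => /=; ring.
Qed.

Lemma twisted_has_mean m b : has_mean (twisted b m) (mean (twisted b m)).
Proof using w_rs.
suff H : forall b, exists c, has_mean (twisted b m) c.
  by have [c Hc] := H b; rewrite (has_mean_mean Hc).
elim/rs_ind: m {b} => [b|m m0 IH b]; first by exists (odd k && ~~ b)%:R; exact: twisted0_mean.
have {}IH (r : 'I_4) c : rs_quo m r != m ->
    has_mean (twisted c (rs_quo m r)) (mean (twisted c (rs_quo m r))).
  by move=> /IH/(_ c)[c' H]; rewrite (has_mean_mean H).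
pose G c i := \sum_(r < 4 | rs_quo m r != m)
  renorm_sum (fun c l => twisted c l i) c m r.
pose g c := \sum_(r < 4 | rs_quo m r != m)
  renorm_sum (fun c l => mean (twisted c l)) c m r.
have Gg c : has_mean (G c) (g c).
  by apply: has_mean_sum => r rm; apply: has_meanZ; exact: IH.
have [r0 /eqP r0m|none] := pickP (fun r : 'I_4 => rs_quo m r == m); last first.
  (* Without a self-loop the whole block sum has a mean by induction, so [u] is 0. *)
  exists (4^-1 * g b).
  apply: (@contraction_has_mean R bool (fun c => twisted c m) G id (fun=> 0)
    g (fun c => 4^-1 * g c) 1) => // [c i|c|c i|c].
  - by rewrite twisted_norm.
  - by rewrite normr0.
  - rewrite twisted_block_sum mul0r add0r /G; apply: eq_bigl => r.
    by rewrite none.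
  - by rewrite mul0r add0r mulVKf // pnatr_eq0.
pose p := odd (rs_high m r0).
pose u c := rs_coef c m r0.
have u2 c : `|u c| <= 2 by rewrite rs_coef_norm ler1n.
have u4 : 4 - u p != 0.
  by rewrite gt_eqF // subr_gt0 (le_lt_trans (ler_norm _)) // (le_lt_trans (u2 p)) // ltr_nat.
(* The mean at parity [p], solved from [4 * x = u p * x + g p]; the self-loop leads to [p] from
   either flag. *)
pose x := g p / (4 - u p).
exists (4^-1 * (u b * x + g b)).
apply: (@contraction_has_mean R bool (fun c => twisted c m) G (fun=> p) u
  g (fun c => 4^-1 * (u c * x + g c)) 1) => // [c i|c i|c].
- by rewrite twisted_norm.
- rewrite twisted_block_sum (bigD1 r0) //=; congr (_ + _).
    by rewrite /renorm_sum r0m.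
  apply: eq_bigl => r; congr negb; apply/eqP/eqP => [->//|rm].
  exact: rs_quo_fix_inj m0 rm r0m.
- by rewrite /x; field.
Qed.

(** Once all means exist, the contraction with the entire block sum as [G] and no self-reference
    gives a quarter of the mean of the block sums. *)
Lemma rs_renorm_corr : rs_renorm (fun m => corr w m) (fun m => signed_corr w m).
Proof using w_rs.
apply/(rs_renormP (fun b m => mean (twisted b m))) => b m.
suff /has_mean_mean -> : has_mean (twisted b m)
    (4^-1 * \sum_r renorm_sum (fun c l => mean (twisted c l)) b m r).
  by rewrite mulVKf // pnatr_eq0.
pose S : R := \sum_r renorm_sum (fun c l => mean (twisted c l)) b m r.
apply: (@contraction_has_mean R unit (fun=> twisted b m)
  (fun=> block_sum (twisted b m)) id (fun=> 0) (fun=> S)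
  (fun=> 4^-1 * S) 1) => // [_ i|_|_|_ i|_].
- by rewrite twisted_norm.
- by rewrite normr0.
- apply: has_mean_eq (fun i => esym (twisted_block_sum b m i)) _.
  by apply: has_mean_sum => r _; apply: has_meanZ; exact: twisted_has_mean.
- by rewrite mul0r add0r.
- by rewrite mul0r add0r mulVKf // pnatr_eq0.
Qed.

End Correlations.
End Renormalisation.

Theorem proposition4p2 (R : realType) (n : nat) (n_ge2 : (2 <= n)%N) :
  (forall w : int -> R, rudin_shapiro w ->
     forall m : 'rV[int]_n.-1,
       cvgn (corr_mean w m) /\ cvgn (signed_corr_mean w m)) /\
  (forall w w' : int -> R, rudin_shapiro w -> rudin_shapiro w' ->
     corr w (0 : 'rV[int]_n.-1) = corr w' (0 : 'rV[int]_n.-1) ->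
     forall m : 'rV[int]_n.-1,
       corr w m = corr w' m /\ signed_corr w m = signed_corr w' m) /\
  (forall w : int -> R, rudin_shapiro w ->
     rs_renorm (fun m : 'rV[int]_n.-1 => corr w m) (fun m => signed_corr w m) /\
     forall f g : 'rV[int]_n.-1 -> R, rs_renorm f g ->
       f 0 = corr w (0 : 'rV[int]_n.-1) ->
       forall m : 'rV[int]_n.-1, f m = corr w m /\ g m = signed_corr w m) /\
  (odd n -> forall w : int -> R, rudin_shapiro w ->
     forall m : 'rV[int]_n.-1, corr w m = 0 /\ signed_corr w m = 0).
Proof.
have renorm := @rs_renorm_corr R n.-1.
split; [|split; [|split]].
- move=> w w_rs m; split; apply/cvg_ex.
    by have /has_mean_cvg := twisted_has_mean w_rs m false; exists (corr w m).
  by have /has_mean_cvg := twisted_has_mean w_rs m true; exists (signed_corr w m).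
- move=> w w' w_rs w'_rs w0 m.
  by have [E E'] := rs_renorm_unique (renorm _ w_rs) (renorm _ w'_rs) w0.
- move=> w w_rs; split=> [|f g fg f0 m]; first exact: renorm.
  by have [E E'] := rs_renorm_unique fg (renorm _ w_rs) f0.
- move=> n_odd w w_rs m.
  have k_even : odd n.-1 = false by rewrite -subn1 oddB ?n_odd // ltnW.
  (* The zero pair solves the linear recursion and for odd $n$ has the right value at lag 0, so
     uniqueness gives the vanishing. *)
  have zero_renorm : rs_renorm (fun _ : 'rV[int]_n.-1 => 0 : R) (fun=> 0).
    by move=> l; rewrite !big1 ?mulr0 // => r _; case: ifP; rewrite mulr0.
  have corr0 : corr w (0 : 'rV[int]_n.-1) = 0.
    have := has_mean_mean (twisted0_mean n.-1 w_rs false).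
    by rewrite k_even.
  by have [E E'] := rs_renorm_unique (renorm _ w_rs) zero_renorm corr0.
Qed.
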